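(* For every integer $k\geq 1$, $\displaystyle \left\vert \mathsf{APS}^B_{2k + 1} \setminus \mathsf{APS}^D_{2k + 1} \right\vert = \binom{2k-1}{k}.$
   Context: For $n\in\mathbb{N}$, $[n]=\{1,\dots,n\}$ and $\pm[n]=[n]\cup -[n]$. The group $\mathfrak{S}_n^B$ of signed permutations consists of the bijections $w:\pm[n]\to\pm[n]$ with $w(-i)=-w(i)$ for all $i$, written in one-line notation $w(1)\cdots w(n)$. $\mathfrak{S}_n^D\subseteq\mathfrak{S}_n^B$ is the subgroup of those $w$ for which $|\{i\in[n]: w(i)<0\}|$ is even. A pinnacle of $w$ is a value $w(i)$ with $2\le i\le n-1$ and $w(i-1)<w(i)>w(i+1)$; the pinnacle set of $w$ is the set of its pinnacles. $\mathsf{APS}^B_n$ (resp. $\mathsf{APS}^D_n$) is the set of subsets of $\pm[n]$ that are the pinnacle set of some $w\in\mathfrak{S}_n^B$ (resp. $w\in\mathfrak{S}_n^D$). *)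

(* Defs.v *)
From mathcomp Require Import all_boot all_order all_algebra all_fingroup.

Set Implicit Arguments.
Unset Strict Implicit.
Unset Printing Implicit Defensive.

Import Order.TTheory GRing.Theory Num.Theory.

(* The set {-n, .., -1, 1, .., n}: the pair (s, i) stands for the integer
   i + 1 when s = false and for -(i + 1) when s = true (see pm_valP). *)
Definition pm (n : nat) : Type := (bool * 'I_n)%type.

Definition pm_val (n : nat) (x : pm n) : int :=
  if x.1 then (- Posz x.2.+1)%R else Posz x.2.+1.

Definition pm_opp (n : nat) (x : pm n) : pm n := (~~ x.1, x.2).

(* The element i + 1 of [n]; ordinals start at 0. *)
Definition pm_pos (n : nat) (i : 'I_n) : pm n := (false, i).

Definition pm_lt (n : nat) (x y : pm n) : bool := (pm_val x < pm_val y)%R.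

Definition signed_permB (n : nat) : {set {perm pm n}} :=
  [set w : {perm pm n} | [forall x, w (pm_opp x) == pm_opp (w x)]].

Definition signed_permD (n : nat) : {set {perm pm n}} :=
  [set w in signed_permB n |
    ~~ odd #|[set i : 'I_n | (pm_val (w (pm_pos i)) < 0)%R]|].

(* The ordinals h, j are the positions immediately before and after i; their
   existence forces i to be an interior position. *)
Definition is_pinnacle_pos (n : nat) (w : {perm pm n}) (i : 'I_n) : bool :=
  [exists h : 'I_n, exists j : 'I_n,
    [&& h.+1 == i, i.+1 == j,
        pm_lt (w (pm_pos h)) (w (pm_pos i))
      & pm_lt (w (pm_pos j)) (w (pm_pos i))]].

Definition pinnacle_set (n : nat) (w : {perm pm n}) : {set pm n} :=
  [set w (pm_pos i) | i : 'I_n & is_pinnacle_pos w i].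

Definition APSB (n : nat) : {set {set pm n}} :=
  [set pinnacle_set w | w in signed_permB n].

Definition APSD (n : nat) : {set {set pm n}} :=
  [set pinnacle_set w | w in signed_permD n].

Lemma pm_val_inj (n : nat) : injective (@pm_val n).
Proof.
move=> [[] i] [[] j]; rewrite /pm_val /= => E.
- by move/oppr_inj: E => [] /val_inj ->.
- by [].
- by [].
- by case: E => /val_inj ->.
Qed.

Lemma pm_valP (n : nat) (z : int) :
  (exists x : pm n, pm_val x = z) <-> (z != 0%R) && (`|z|%N <= n).
Proof.
split=> [[[[] i] <-]|]; rewrite /pm_val /=.
- by rewrite ltn_ord.
- by rewrite ltn_ord.
case: z => [[|m]|m] //= lmn; first by exists (false, Ordinal lmn).
by exists (true, Ordinal lmn).
Qed.

Lemma pm_val_opp (n : nat) (x : pm n) : pm_val (pm_opp x) = (- pm_val x)%R.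
Proof. by case: x => [[] i]; rewrite /pm_val /= ?opprK. Qed.

(* Main.v *)
(** Let [W] be the set of one-line values of a signed permutation and [S] its
pinnacle set.  Sorting [S] and [W \ S] and interleaving them shows that, for
given [W] and [S], such a permutation exists iff every [s] in [S] satisfies
#{x in S, x <= s} < #{v in W \ S, v < s}.  Making all non-pinnacles negative
preserves this condition, and the parity of the number of negative values can
then be corrected by making the non-pinnacle of least absolute value [m]
positive, unless [S] has [k] elements, all of them smaller than [m] (for
[n = 2k+1]).  So a set [S] in APS^B but not in APS^D is given by the set [Q] of
absolute values of its negative elements: its positive elements are the
[k - #|Q|] smallest elements outside [Q].  Reading [2k+1, .., 1] with a step
down for the elements of [Q] and a step up for the others, the conditions on
[Q] are that the path stays positive and that [k + #|Q|] is even.  The last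
step is free for positivity and forced by parity, which leaves the positive
paths of length [2k], of which there are C(2k-1, k). *)

Require Import Defs.
From mathcomp Require Import all_boot all_order all_algebra all_fingroup.
From mathcomp Require Import zify.

Set Implicit Arguments.
Unset Strict Implicit.
Unset Printing Implicit Defensive.

Import Order.TTheory.

(** * Pinnacle sets of signed permutations with given values *)

Definition line_set n (w : {perm pm n}) : {set pm n} :=
  [set w (pm_pos i) | i : 'I_n].

(** Together with the cardinality, injectivity of the absolute value means that exactly one element
    of each pair [v], [-v] is chosen. *)
Definition abs_transversal n (W : {set pm n}) :=
  #|W| = n /\ {in W &, injective snd}.

Definition dominated n (S W : {set pm n}) := forall s, s \in S ->
  #|[set x in S | ~~ pm_lt s x]| < #|[set v in W :\: S | pm_lt v s]|.

Lemma pm_ltxx n (x : pm n) : pm_lt x x = false.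
Proof. by rewrite /pm_lt ltxx. Qed.

Lemma pm_lt_trans n : transitive (@pm_lt n).
Proof. by move=> y x z; rewrite /pm_lt; apply: lt_trans. Qed.

Lemma pm_pos_inj n : injective (@pm_pos n).
Proof. by move=> i j []. Qed.

Lemma line_inj n (w : {perm pm n}) : injective (fun i => w (pm_pos i)).
Proof. by move=> i j /perm_inj /pm_pos_inj. Qed.

Lemma mem_pinnacle_set n (w : {perm pm n}) i :
  (w (pm_pos i) \in pinnacle_set w) = is_pinnacle_pos w i.
Proof.
apply/imsetP/idP => [[j]|pi]; last by exists i; rewrite ?inE.
by rewrite inE => pj /line_inj ->.
Qed.

Lemma signed_permB_opp n (w : {perm pm n}) x :
  w \in signed_permB n -> w (pm_opp x) = pm_opp (w x).
Proof. by rewrite inE => /forallP /(_ x) /eqP. Qed.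

Lemma line_set_transversal n (w : {perm pm n}) :
  w \in signed_permB n -> abs_transversal (line_set w).
Proof.
move=> wB; split; first by rewrite card_imset ?card_ord //; apply: line_inj.
move=> _ _ /imsetP[i _ ->] /imsetP[j _ ->] eij.
case: (w (pm_pos i) =P w (pm_pos j)) => // ne.
(* Distinct values of equal absolute value are opposite, so [w] would agree at [i] and at [-j],
   which differ in sign. *)
have : w (pm_pos i) = w (pm_opp (pm_pos j)).
  rewrite signed_permB_opp // /pm_opp.
  by case: (w (pm_pos i)) (w (pm_pos j)) eij ne => [[] a] [[] b] /= ->.
by move/perm_inj.
Qed.

Lemma pinnacle_set_sub n (w : {perm pm n}) : pinnacle_set w \subset line_set w.
Proof. by apply/subsetP => _ /imsetP[i _ ->]; apply: imset_f. Qed.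

(* The left neighbours of the pinnacles [<= s], together with the right
   neighbour of the last of them, are non-pinnacles [< s]. *)
Lemma pinnacle_set_dominated n (w : {perm pm n}) :
  dominated (pinnacle_set w) (line_set w).
Proof.
move=> s sS.
pose I := [set i | is_pinnacle_pos w i && ~~ pm_lt s (w (pm_pos i))].
pose J := [set h | ~~ is_pinnacle_pos w h && pm_lt (w (pm_pos h)) s].
have -> : [set x in pinnacle_set w | ~~ pm_lt s x] = [set w (pm_pos i) | i in I].
  apply/setP => x; rewrite inE; apply/andP/imsetP => [[xS xs]|[i]].
    have [i _ xi] := imsetP (subsetP (pinnacle_set_sub w) _ xS).
    by exists i; rewrite // inE -mem_pinnacle_set -xi xS.
  by rewrite inE => /andP[pi xi] ->; rewrite mem_pinnacle_set.
rewrite card_imset; last exact: line_inj.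
apply: (@leq_trans #|[set w (pm_pos h) | h in J]|); last first.
  apply/subset_leq_card/subsetP => _ /imsetP[h hJ ->].
  move: hJ; rewrite !inE => /andP[nh lh].
  by rewrite mem_pinnacle_set nh lh imset_f.
rewrite card_imset; last exact: line_inj.
(* A neighbour of a pinnacle is smaller than it, hence cannot itself be a pinnacle. *)
have neigh i (h : 'I_n) : i \in I -> (h.+1 == i) || (i.+1 == h) -> h \in J.
  rewrite inE => /andP[/existsP[a /existsP[b /and4P[/eqP ai /eqP ib la lb]]] xi] hi.
  have lhi : pm_lt (w (pm_pos h)) (w (pm_pos i)).
    case/orP: hi => /eqP hi.
      by have -> : h = a by apply: ord_inj; lia.
    by have -> : h = b by apply: ord_inj; lia.
  rewrite inE; apply/andP; split; last by move: xi lhi; rewrite /pm_lt; lia.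
  apply/negP => /existsP[c /existsP[d /and4P[/eqP ch /eqP hd lc ld]]].
  have : i = c \/ i = d.
    by case/orP: hi => /eqP hi; [right|left]; apply: ord_inj; lia.
  by case=> e; move: lc ld lhi; rewrite e /pm_lt; lia.
have [i0 i0I] : exists i, i \in I.
  have [i _ si] := imsetP (subsetP (pinnacle_set_sub w) _ sS).
  by exists i; rewrite inE -mem_pinnacle_set -si sS pm_ltxx.
case: (@arg_maxnP _ i0 (mem I) (@nat_of_ord n) i0I) => m; rewrite -[mem I m]/(m \in I) => mI mmax.
have mJ : exists2 j : 'I_n, j \in J & j = m.+1 :> nat.
  move: (mI); rewrite inE => /andP[/existsP[a /existsP[b /and4P[_ /eqP mb _ _]]] _].
  by exists b => //; apply: (neigh m) => //; rewrite mb eqxx orbT.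
have gt0 i : i \in I -> 0 < i.
  rewrite inE => /andP[/existsP[a /existsP[b /and4P[/eqP mb _ _ _]]] _].
  by rewrite -mb.
(* The left neighbour. Truncation at 0 does no harm, since positions in [I] are positive. *)
pose pr (i : 'I_n) : 'I_n := Ordinal (leq_ltn_trans (leq_pred i) (ltn_ord i)).
rewrite -(card_in_imset (f := pr) (D := mem I)); last first.
  move=> i j iI jI /(congr1 val) /= e; apply: ord_inj => /=.
  by have := gt0 _ iI; have := gt0 _ jI; lia.
apply: proper_card; apply/properP; split.
  apply/subsetP => _ /imsetP[i iI ->]; apply: (neigh i) => //=.
  by rewrite prednK ?eqxx // gt0.
case: mJ => j jJ jm; exists j => //; apply/imsetP => -[i iI e].
have im : i <= m := mmax _ iI.
by have := gt0 _ iI; move/(congr1 (@nat_of_ord n)): e; rewrite /= jm; lia.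
Qed.

Lemma sorted_enum_pm n (A : {set pm n}) : exists s : seq (pm n),
  [/\ uniq s, s =i A & forall x i j, i < j -> j < size s ->
      pm_lt (nth x s i) (nth x s j)].
Proof.
pose le (x y : pm n) := (pm_val x <= pm_val y)%R.
have le_tot : total le by move=> x y; apply: le_total.
exists (sort le (enum A)); split.
- by rewrite sort_uniq enum_uniq.
- by move=> x; rewrite mem_sort mem_enum.
move=> x i j ij js.
have so : sorted (@pm_lt n) (sort le (enum A)).
  have := sort_sorted le_tot (enum A).
  rewrite -[sorted le _]/(sorted (relpre (@pm_val n) <=%R) _) -sorted_map.
  rewrite -[sorted _ _ in X in _ -> X]/(sorted (relpre (@pm_val n) <%R) _).
  rewrite -[in X in _ -> X]sorted_map.
  rewrite lt_sorted_uniq_le (map_inj_uniq (@pm_val_inj n)) sort_uniq enum_uniq.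
  by move->.
have il : i < size (sort le (enum A)) by apply: ltn_trans js.
exact: (sorted_ltn_nth (@pm_lt_trans n) x so).
Qed.

Lemma signed_perm_of_line n (f : 'I_n -> pm n) : injective (fun i => (f i).2) ->
  exists2 w, w \in signed_permB n & forall i, w (pm_pos i) = f i.
Proof.
(* The odd extension of [f]: the sign of the position is multiplied into that of the value. *)
move=> finj; pose g (x : pm n) : pm n := (x.1 (+) (f x.2).1, (f x.2).2).
have ginj : injective g.
  by move=> [a i] [b j] [] /= + /finj e; rewrite e => /addIb ->.
exists (perm ginj); last by move=> i; rewrite permE /g -surjective_pairing.
rewrite inE; apply/forallP => -[a i]; rewrite !permE /g /pm_opp /=.
by rewrite addNb.
Qed.

(* With both parts sorted, [v_0 s_0 v_1 s_1 .. v_(j-1) s_(j-1) v_j v_(j+1) ..]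
   has pinnacle set [S]. *)
Lemma dominated_pinnacle_set n (S W : {set pm n}) :
  S \subset W -> abs_transversal W -> dominated S W ->
  exists2 w, w \in signed_permB n & pinnacle_set w = S /\ line_set w = W.
Proof.
move=> SW [cW iW] dom.
(* [x0] serves as the default of [nth]. It is missing only for [n = 0], where the identity works. *)
have [x0 _|nopm] := pickP (@predT (pm n)); last first.
  exists 1%g; last split.
  - by rewrite inE; apply/forallP => x; have := nopm x.
  - by apply/setP => x; have := nopm x.
  - by apply/setP => x; have := nopm x.
have [ss [ssu ssS ssl]] := sorted_enum_pm S.
have [vs [vsu vsV vsl]] := sorted_enum_pm (W :\: S).
have szs : size ss = #|S| by rewrite -(card_uniqP ssu); apply: eq_card.
have szv : size vs = #|W :\: S| by rewrite -(card_uniqP vsu); apply: eq_card.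
have szn : size ss + size vs = n.
  by have := cardsID S W; rewrite (setIidPr SW) cW szs szv.
(* At least [i + 1] elements of [S] are at most [s_i], so domination puts at least [i + 2]
   non-pinnacles below [s_i], among them [v_(i+1)]. *)
have key i : i < size ss -> i.+1 < size vs /\ pm_lt (nth x0 vs i.+1) (nth x0 ss i).
  move=> li; have := dom (nth x0 ss i); rewrite -ssS mem_nth // => /(_ isT) h.
  apply/andP; apply/negPn/negP => nh.
  have hv : #|[set v in W :\: S | pm_lt v (nth x0 ss i)]| <= i.+1.
    apply: leq_trans (_ : size (take i.+1 vs) <= _); last by rewrite size_take; case: ifP => //; lia.
    apply: leq_trans (card_size _); apply/subset_leq_card/subsetP => v.
    rewrite inE -vsV => /andP[vv lv].
    have iv : index v vs < size vs by rewrite index_mem.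
    rewrite in_take // ltnNge; apply/negP => le.
    case/negP: nh; rewrite (leq_ltn_trans le iv) /=.
    move: le; rewrite leq_eqVlt => /orP[/eqP ->|lt]; first by rewrite nth_index.
    by apply: pm_lt_trans lv; rewrite -[X in pm_lt _ X](nth_index x0 vv) vsl.
  have hs : i < #|[set x in S | ~~ pm_lt (nth x0 ss i) x]|.
    have <- : size (take i.+1 ss) = i.+1.
      by rewrite size_take; case: ifP => //; lia.
    rewrite -(card_uniqP (take_uniq _ ssu)).
    apply/subset_leq_card/subsetP => x xt; have xs := mem_take xt.
    rewrite inE -ssS xs /=; move: xt; rewrite in_take // ltnS => le.
    rewrite -[X in pm_lt _ X](nth_index x0 xs).
    move: le; rewrite leq_eqVlt => /orP[/eqP ->|lt]; first by rewrite pm_ltxx.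
    by move: (ssl x0 _ _ lt li); rewrite /pm_lt -leNgt; apply: ltW.
  lia.
(* Pinnacles occupy the odd positions below [2 * #|S|]. The index [e p] into the relevant sorted
   list is [p./2] in the interleaved part; in the tail, where [ss] is used up, it is [p - #|S|]. *)
pose isS p := (p < 2 * size ss) && odd p.
pose e p := if p < 2 * size ss then p./2 else p - size ss.
pose f p := nth x0 (if isS p then ss else vs) (e p).
have eS p : isS p -> e p < size ss by rewrite /isS /e => /andP[lp _]; rewrite lp; lia.
have eV p : p < n -> ~~ isS p -> e p < size vs.
  rewrite /isS /e; case: ifP => /= [lp|]; last by lia.
  move=> pn op; have /key[] : p./2 < size ss by lia.
  lia.
have fS p : isS p -> f p \in S by move=> sp; rewrite /f sp -ssS mem_nth // eS.
have fV p : p < n -> ~~ isS p -> f p \in W :\: S.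
  by move=> pn sp; rewrite /f (negPf sp) -vsV mem_nth // eV.
have fW p : p < n -> f p \in W.
  move=> pn; case: (boolP (isS p)) => sp; first exact: (subsetP SW _ (fS _ sp)).
  by have := fV _ pn sp; rewrite inE => /andP[].
have fSE p : p < n -> (f p \in S) = isS p.
  move=> pn; case: (boolP (isS p)) => sp; first exact: fS.
  by have := fV _ pn sp; rewrite inE => /andP[/negPf].
have finj p q : p < n -> q < n -> f p = f q -> p = q.
  move=> pn qn E; have := fSE p pn; rewrite E fSE // => Es.
  have Ee : e p = e q.
    move: E; rewrite /f Es; case: (boolP (isS p)) => sp.
      move/eqP; rewrite nth_uniq //; first by move/eqP.
        exact: eS.
      by apply: eS; rewrite Es.
    move/eqP; rewrite nth_uniq //; first by move/eqP.
      exact: eV.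
    by apply: eV; rewrite ?Es.
  by move: Es Ee; rewrite /isS /e; do 2!case: ifP; lia.
have fVlt p q : p < q -> q < n -> ~~ isS p -> ~~ isS q -> pm_lt (f p) (f q).
  move=> pq qn sp sq; have := eV _ qn sq.
  rewrite /f (negPf sp) (negPf sq) => lq; apply: vsl => //.
  by move: pq sp sq; rewrite /isS /e; do 2!case: ifP; lia.
(* The right neighbour [v_(i+1)] of [s_i] lies below it by [key]; the left neighbour [v_i] is
   smaller still. *)
have fup p : isS p -> [/\ 0 < p, p.+1 < n, pm_lt (f p.-1) (f p) & pm_lt (f p.+1) (f p)].
  move=> sp; have [kn kl] := key _ (eS _ sp).
  have sp1 : ~~ isS p.-1 by move: sp; rewrite /isS; lia.
  have sp2 : ~~ isS p.+1 by move: sp; rewrite /isS; lia.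
  have pn : p.+1 < n by move: sp kn; rewrite /isS /e; case: ifP; lia.
  have l2 : pm_lt (f p.+1) (f p).
    rewrite /f (negPf sp2) sp.
    suff -> : e p.+1 = (e p).+1 by [].
    by move: sp; rewrite /isS /e; do 2!case: ifP; lia.
  have p0 : 0 < p by move: sp; rewrite /isS; lia.
  split=> //; apply: pm_lt_trans l2; apply: fVlt => //; lia.
have [w wB wf] : exists2 w, w \in signed_permB n & forall i : 'I_n, w (pm_pos i) = f i.
  apply: signed_perm_of_line => i j /iW E; apply: ord_inj; apply: finj => //.
  by apply: E; apply: fW.
have lW : line_set w = W.
  apply/eqP; rewrite eqEcard cW card_imset ?card_ord ?leqnn ?andbT; last exact: line_inj.
  by apply/subsetP => _ /imsetP[i _ ->]; rewrite wf fW.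
exists w => //; split=> //.
have pinE i : is_pinnacle_pos w i = isS i.
  apply/idP/idP => [|/fup[i0 ni l1 l2]].
    case/existsP=> h /existsP[j /and4P[/eqP hi /eqP ij]]; rewrite !wf => lh lj.
    apply/negPn/negP => si.
    (* If [j] carried an element of [S], its left neighbour [i] would be lower. So [i] and [j] both
       carry non-pinnacles, which increase from left to right, against [lj]. *)
    have sj : ~~ isS j.
      apply/negP => /fup[_ _ + _]; rewrite -ij /=.
      by move: lj; rewrite -ij /pm_lt; lia.
    have := fVlt i j; rewrite -{1}ij => /(_ _ _ si sj).
    by move: lj; rewrite /pm_lt => ? /(_ (leqnn _) (ltn_ord j)); lia.
  have hn : i.-1 < n by lia.
  apply/existsP; exists (Ordinal hn); apply/existsP; exists (Ordinal ni).
  by rewrite !wf /= prednK // !eqxx l1 l2.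
apply/setP => x; apply/idP/idP => [/imsetP[i]|xS].
  by rewrite inE pinE => si ->; rewrite wf fS.
have : x \in line_set w by rewrite lW (subsetP SW).
case/imsetP=> i _ xi; rewrite xi mem_pinnacle_set pinE -fSE //.
by rewrite -wf -xi.
Qed.

(** * Sets that are pinnacle sets in type B only *)

Definition abs_set n (S : {set pm n}) : {set 'I_n} := [set x.2 | x in S].

(** The value set most favourable to domination by non-pinnacles: every absolute value missing from
    [S] gets a negative sign. *)
Definition neg_fill n (S : {set pm n}) : {set pm n} :=
  S :|: [set x | x.1 && (x.2 \notin abs_set S)].

Definition negs n (W : {set pm n}) : {set pm n} := [set x in W | x.1].

Lemma APSB_transversalP n (S : {set pm n}) :
  reflect (exists W : {set pm n}, [/\ S \subset W, abs_transversal W & dominated S W])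
          (S \in APSB n).
Proof.
apply: (iffP imsetP) => [[w wB ->]|[W [SW tW dW]]].
  exists (line_set w); split; [exact: pinnacle_set_sub| |exact: pinnacle_set_dominated].
  exact: line_set_transversal.
by have [w wB [<- _]] := dominated_pinnacle_set SW tW dW; exists w.
Qed.

Lemma card_negs_line_set n (w : {perm pm n}) :
  #|[set i : 'I_n | (pm_val (w (pm_pos i)) < 0)%R]| = #|negs (line_set w)|.
Proof.
rewrite -(card_imset _ (@line_inj n w)); congr #|pred_of_set _|.
have neg (x : pm n) : (pm_val x < 0)%R = x.1 by case: x => -[] i.
apply/setP => x; rewrite inE; apply/imsetP/andP => [[i]|[/imsetP[i _ ->] xn]].
  by rewrite inE neg => ni ->; rewrite imset_f.
by exists i => //; rewrite inE neg.
Qed.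

Lemma APSD_transversalP n (S : {set pm n}) :
  reflect (exists W : {set pm n}, [/\ S \subset W, abs_transversal W, dominated S W
                       & ~~ odd #|negs W|])
          (S \in APSD n).
Proof.
apply: (iffP imsetP) => [[w]|[W [SW tW dW oW]]].
  rewrite inE card_negs_line_set => /andP[wB oW] ->; exists (line_set w).
  split=> //; [exact: pinnacle_set_sub|exact: line_set_transversal|].
  exact: pinnacle_set_dominated.
have [w wB [<- lW]] := dominated_pinnacle_set SW tW dW; exists w => //.
by rewrite inE wB card_negs_line_set lW.
Qed.

Lemma abs_transversal_full n (W : {set pm n}) :
  {in W &, injective snd} -> abs_set W = [set: 'I_n] -> abs_transversal W.
Proof. by move=> iW aW; split=> //; rewrite -(card_in_imset iW) -/(abs_set W) aW cardsT card_ord. Qed.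

Lemma abs_setT n (W : {set pm n}) : abs_transversal W -> abs_set W = [set: 'I_n].
Proof.
case=> cW iW; apply/eqP; rewrite eqEcard subsetT cardsT card_ord.
by rewrite card_in_imset // cW leqnn.
Qed.

Lemma abs_setD n (S W : {set pm n}) :
  S \subset W -> abs_transversal W -> abs_set (W :\: S) = ~: abs_set S.
Proof.
move=> SW tW; have [_ iW] := tW; apply/setP => i; rewrite inE.
apply/imsetP/idP => [[x]|iS].
  rewrite inE => /andP[xS xW] ->; apply/negP => /imsetP[y yS /iW e].
  by move: xS; rewrite e ?yS ?(subsetP SW _ yS).
have : i \in abs_set W by rewrite abs_setT.
case/imsetP=> x xW ix; exists x => //; rewrite inE xW andbT.
by apply: contra iS => xS; rewrite ix imset_f.
Qed.

Lemma card_setD_transversal n (S W : {set pm n}) :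
  S \subset W -> abs_transversal W -> #|S| + #|W :\: S| = n.
Proof. by move=> SW [cW _]; have := cardsID S W; rewrite (setIidPr SW) cW. Qed.

Lemma mem_neg_fillD n (S : {set pm n}) (x : pm n) :
  (x \in neg_fill S :\: S) = x.1 && (x.2 \notin abs_set S).
Proof.
rewrite !inE; case: (boolP (x \in S)) => //= xS.
by rewrite imset_f //= andbF.
Qed.

Lemma neg_fill_sub n (S : {set pm n}) : S \subset neg_fill S.
Proof. exact: subsetUl. Qed.

Lemma neg_fill_transversal n (S : {set pm n}) :
  {in S &, injective snd} -> abs_transversal (neg_fill S).
Proof.
move=> iS; apply: abs_transversal_full.
  move=> x y; rewrite !inE => /orP[xS|/andP[x1 xS]] /orP[yS|/andP[y1 yS]] e.
  - exact: iS.
  - by move: yS; rewrite -e imset_f.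
  - by move: xS; rewrite e imset_f.
  - by case: x y x1 y1 e {xS yS} => [[] a] [[] b] //= _ _ ->.
apply/setP => i; rewrite inE; case: (boolP (i \in abs_set S)) => [|iS'].
  by case/imsetP=> x xS ->; rewrite imset_f // inE xS.
by apply/imsetP; exists (true, i); rewrite // !inE iS' orbT.
Qed.

(** Making a non-pinnacle negative never raises it, so no [s] loses a non-pinnacle below it. *)
Lemma dominated_neg_fill n (S W : {set pm n}) :
  S \subset W -> abs_transversal W -> dominated S W -> dominated S (neg_fill S).
Proof.
move=> SW tW dW s sS; apply: leq_trans (dW s sS) _.
pose g (x : pm n) : pm n := (true, x.2).
have ginj : {in [set v in W :\: S | pm_lt v s] &, injective g}.
  have [_ iW] := tW.
  move=> x y; rewrite !inE => /andP[/andP[_ xW] _] /andP[/andP[_ yW] _] [].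
  exact: iW.
rewrite -(card_in_imset ginj); apply/subset_leq_card/subsetP => _ /imsetP[x + ->].
rewrite inE => /andP[xV xs]; rewrite inE mem_neg_fillD /=.
apply/andP; split.
  by have := abs_setD SW tW => /setP/(_ x.2); rewrite inE => <-; rewrite imset_f.
by move: xs; rewrite /g /pm_lt /pm_val /=; case: x {xV} => -[] i /=; lia.
Qed.

Lemma APSBP n (S : {set pm n}) :
  reflect ({in S &, injective snd} /\ dominated S (neg_fill S)) (S \in APSB n).
Proof.
apply: (iffP (APSB_transversalP S)) => [[W [SW tW dW]]|[iS dS]].
  split; last exact: dominated_neg_fill dW.
  by have [_ iW] := tW; apply: sub_in2 iW; apply/subsetP.
exists (neg_fill S); split=> //; first exact: neg_fill_sub.
exact: neg_fill_transversal.
Qed.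

Lemma pm_max_exists n (S : {set pm n}) : S != set0 ->
  exists2 s, s \in S & forall x, x \in S -> ~~ pm_lt s x.
Proof.
case/set0Pn=> x0 x0S.
case: (arg_maxP (@pm_val n) (P := mem S) x0S) => s sS smax.
by exists s => // x xS; rewrite /pm_lt -leNgt; apply: smax.
Qed.

Lemma dominated_card n (S W : {set pm n}) (s : pm n) :
  s \in S -> dominated S W -> #|S| < #|W :\: S|.
Proof.
move=> sS dS; have [|m mS mmax] := @pm_max_exists n S; first by apply/set0Pn; exists s.
have := dS m mS.
have -> : [set x in S | ~~ pm_lt m x] = S.
  by apply/setP => x; rewrite inE; case: (boolP (x \in S)) => //= /mmax.
move=> h; apply: leq_trans h _; apply/subset_leq_card/subsetP => x.
by rewrite inE => /andP[].
Qed.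

(** Since [neg_fill S] dominates, it must have the wrong parity. Replacing the non-pinnacle [-m] of
    least absolute value by [m] repairs the parity, so domination must then fail at some [s]. This
    failure is so tight that it determines [#|S|] and makes [s] the maximum of [S], below [m]. *)
Lemma APSBD_necessary k (S : {set pm (2 * k + 1)}) :
  S \in APSB _ -> S \notin APSD _ ->
  [/\ #|S| = k, forall s v, s \in S -> v \notin abs_set S -> pm_lt s (false, v)
    & odd #|negs (neg_fill S)|].
Proof.
move=> /APSBP[iS dS] SnD; have SW := neg_fill_sub S.
have tW := neg_fill_transversal iS.
have oW : odd #|negs (neg_fill S)|.
  apply/negPn/negP => oW; case/APSD_transversalP: SnD.
  by exists (neg_fill S).
have cV := card_setD_transversal SW tW.
have [v0 v0S] : exists v, v \in ~: abs_set S.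
  have [|x xV] := set0Pn (neg_fill S :\: S) _.
    have [S0|/set0Pn[s sS]] := eqVneq S set0.
      by rewrite -card_gt0; move: cV; rewrite S0 cards0; lia.
    by rewrite -card_gt0; apply: leq_ltn_trans (dominated_card sS dS).
  by exists x.2; rewrite -(abs_setD SW tW) imset_f.
case: (@arg_minnP _ v0 (mem (~: abs_set S)) (@nat_of_ord _) v0S) => m.
rewrite -[mem _ m]/(m \in ~: abs_set S) inE => mS mmin.
have mW : (true, m) \in neg_fill S :\: S by rewrite mem_neg_fillD.
have {}mmin v : v \notin abs_set S -> m <= v by move=> vS; apply: mmin; rewrite /= inE.
have nS b : (b, m) \notin S by apply: contra mS => /(imset_f snd).
pose W1 := (false, m) |: (neg_fill S :\ (true, m)).
have SW1 : S \subset W1.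
  apply/subsetP => x xS; rewrite !inE xS /=.
  by case: eqP => //= _; rewrite ?andbT; apply/eqP => e; move: xS; rewrite e (negPf (nS _)).
have absm x : x \in neg_fill S -> x.2 = m -> x = (true, m).
  move=> xW; have [_ iW] := tW => /= e; apply: iW => //.
  by move: mW; rewrite inE => /andP[].
have mnW : (false, m) \notin neg_fill S by apply/negP => /absm /(_ erefl).
have tW1 : abs_transversal W1.
  split.
    have [cW _] := tW; rewrite cardsU1 !inE (negPf (nS _)) /= -[RHS]cW.
    rewrite (cardsD1 (true, m) (neg_fill S)).
    by move: mW; rewrite inE => /andP[_ ->].
  have [_ iW] := tW.
  move=> x y; rewrite in_setU1 in_setU1 !in_setD1.
  case/orP=> [/eqP ->|/andP[xm xW]] /orP[/eqP ->|/andP[ym yW]] //= e.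
  - by move: ym; rewrite (absm y) ?eqxx.
  - by move: xm; rewrite (absm x) ?eqxx.
  - exact: iW.
have oW1 : ~~ odd #|negs W1|.
  suff e : #|negs (neg_fill S)| = #|negs W1|.+1 by move: oW; rewrite e.
  rewrite (cardsD1 (true, m)).
  have -> : (true, m) \in negs (neg_fill S).
    by rewrite inE /= andbT; move: mW; rewrite inE => /andP[].
  congr _.+1; congr #|pred_of_set _|; apply/setP => x.
  rewrite in_setD1 in_set [RHS]in_set in_setU1 in_setD1.
  case: (x =P (false, m)) => [->|_] //=.
    by rewrite andbF.
  by rewrite andbA.
have [s sS sle] : exists2 s, s \in S &
    #|[set v in W1 :\: S | pm_lt v s]| <= #|[set x in S | ~~ pm_lt s x]|.
  case: (boolP [exists s in S, #|[set v in W1 :\: S | pm_lt v s]|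
                        <= #|[set x in S | ~~ pm_lt s x]|]).
    by case/existsP=> s /andP[sS h]; exists s.
  move/existsPn => h; case/APSD_transversalP: SnD; exists W1; split=> // s sS.
  by have := h s; rewrite sS /= -ltnNge.
have cW1 := card_setD_transversal SW1 tW1.
have slt := dS s sS.
have cS := dominated_card sS dS.
have W1D x : x \in W1 :\: S -> x = (false, m) \/ x \in neg_fill S :\: S.
  by rewrite !inE => /andP[-> /orP[/eqP->|/andP[_ ->]]]; [left|right].
have WD x : x \in neg_fill S :\: S -> x = (true, m) \/ x \in W1 :\: S.
  rewrite !in_setD in_setU1 in_setD1 => /andP[-> ->]; rewrite andbT.
  by case: (x =P (true, m)) => [->|_]; [left|right; rewrite orbT].
(* If [m] were below [s], so would be all of [W1 :\: S], and the replacement would not have lowered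
   the count. *)
have nsm : ~~ pm_lt (false, m) s.
  apply/negP => ms; move: slt; rewrite ltnNge => /negP; apply; apply: leq_trans sle.
  have -> : [set v in W1 :\: S | pm_lt v s] = W1 :\: S.
    apply/setP => x; rewrite inE; case: (boolP (x \in _)) => //= /W1D[->//|].
    rewrite mem_neg_fillD => /andP[x1 _]; move: ms x1.
    by case: x => -[] a //= + _; apply: pm_lt_trans.
  apply: (@leq_trans #|neg_fill S :\: S|); last by rewrite -(leq_add2l #|S|) cV cW1.
  by apply/subset_leq_card/subsetP => x; rewrite inE => /andP[].
(* Otherwise [-m] was not counted below [s], and removing it could not break domination. *)
have msm : pm_lt (true, m) s.
  apply/negPn/negP => ms; move: slt; rewrite ltnNge => /negP; apply; apply: leq_trans sle.
  apply/subset_leq_card/subsetP => x; rewrite inE [in X in _ -> X]inE.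
  by case/andP=> /WD[->|-> ->//]; rewrite (negPf ms).
(* By minimality of [m], [-m] is the largest element of [neg_fill S :\: S]; as [-m] is below [s], so
   are all the others. *)
have geS : #|neg_fill S :\: S| <= #|[set v in W1 :\: S | pm_lt v s]|.+1.
  rewrite (cardsD1 (true, m) (neg_fill S :\: S)) mW add1n ltnS.
  apply/subset_leq_card/subsetP => x; rewrite in_setD1 => /andP[/eqP xm xW].
  rewrite inE; case: (WD x xW) => [//|-> /=].
  apply: pm_lt_trans msm; move: xW; rewrite mem_neg_fillD => /andP[x1 /mmin].
  case: x xm x1 => -[] a //= xm _ ma; rewrite /pm_lt /pm_val /=.
  have ne : nat_of_ord m <> a by move=> /ord_inj e; case: xm; rewrite e.
  by move: ma ne; clear; lia.
have eS : [set x in S | ~~ pm_lt s x] = S.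
  apply/eqP; rewrite eqEcard; apply/andP; split.
    by apply/subsetP => x; rewrite inE => /andP[].
  by rewrite -ltnS (leq_trans cS) // (leq_trans geS).
split=> // [|x v xS vS].
  by move: cV cS geS sle; rewrite eS; clear; lia.
have xs : ~~ pm_lt s x by move: xS; rewrite -{1}eS inE => /andP[].
have nsm' : pm_val s <> pm_val (false, m).
  by move/pm_val_inj => e; move: sS; rewrite e (negPf (nS _)).
move: (mmin v vS) xs nsm nsm'; rewrite /pm_lt.
by rewrite -[pm_val (false, m)]/(Posz m.+1) -[pm_val (false, v)]/(Posz v.+1); clear; lia.
Qed.

(** Domination at the maximum of [S], which exists as [k > 0], needs all [k + 1] non-pinnacles below
    it. A positive one would lie above [S], so the value set can only be [neg_fill S], of odd
    parity. *)
Lemma APSBD_sufficient k (S : {set pm (2 * k + 1)}) : 0 < k ->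
  #|S| = k -> (forall s v, s \in S -> v \notin abs_set S -> pm_lt s (false, v)) ->
  odd #|negs (neg_fill S)| -> S \notin APSD _.
Proof.
move=> k0 cS Slt oW; apply/APSD_transversalP => -[W [SW tW dW oW']].
have cV := card_setD_transversal SW tW.
suff WN : W = neg_fill S by move: oW'; rewrite WN oW.
have [|s sS smax] := @pm_max_exists _ S; first by rewrite -card_gt0 cS.
have := dW s sS.
have -> : [set x in S | ~~ pm_lt s x] = S.
  by apply/setP => x; rewrite inE; case: (boolP (x \in S)) => //= /smax.
move=> lt.
have Vs : [set v in W :\: S | pm_lt v s] = W :\: S.
  apply/eqP; rewrite eqEcard; apply/andP; split; last by lia.
  by apply/subsetP => x; rewrite inE => /andP[].
have iS : {in S &, injective snd}.
  by have [_ iW] := tW; apply: sub_in2 iW; apply/subsetP.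
have [cW _] := tW; have [cN _] := neg_fill_transversal iS.
apply/eqP; rewrite eqEcard cW cN leqnn andbT; apply/subsetP => x xW.
rewrite !inE; case: (boolP (x \in S)) => //= xS.
have xV : x \in W :\: S by rewrite inE xS.
have nx : x.2 \notin abs_set S.
  by have := abs_setD SW tW => /setP/(_ x.2); rewrite inE => <-; rewrite imset_f.
rewrite nx andbT; move: xV; rewrite -Vs inE => /andP[_ xs].
have := Slt s x.2 sS nx; move: xs; rewrite /pm_lt.
by case: x {xW xS nx} => -[] a //=; lia.
Qed.

(** * Positive paths *)

(* Words are read from their last letter to the first, so that prepending a
   letter extends the path; [true] is a step down. *)
Fixpoint positive_path (s : seq bool) : bool :=
  if s is b :: s' then (count id s < count negb s) && positive_path s' else true.

Lemma positive_path_drop s :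
  reflect (forall i, i < size s -> count id (drop i s) < count negb (drop i s))
          (positive_path s).
Proof.
elim: s => [|b s IH]; first by apply: ReflectT.
apply: (iffP andP) => [[h /IH hs] [|i] //|h].
  by rewrite drop_cons ltnS; apply: hs.
split; first by have := h 0 isT; rewrite drop0.
by apply/IH => i si; have := h i.+1 si.
Qed.

Lemma card_tupleS m (p : pred (seq bool)) :
  #|[set t : m.+1.-tuple bool | p t]| =
  #|[set t : m.-tuple bool | p (true :: t)]| + #|[set t : m.-tuple bool | p (false :: t)]|.
Proof.
have cinj b : injective (fun t : m.-tuple bool => [tuple of b :: t]).
  by move=> t u /(congr1 val) [] /val_inj.
rewrite -(card_imset _ (cinj true)) -(card_imset _ (cinj false)) -cardsUI.
rewrite [X in _ + X](_ : _ = 0) ?addn0; last first.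
  apply/eqP; rewrite cards_eq0; apply/eqP/setP => t; rewrite !inE.
  by apply/negP => /andP[/imsetP[u _ ->] /imsetP[v _ /(congr1 val)]].
congr #|pred_of_set _|; apply/setP => t; rewrite !inE.
apply/idP/orP => [|[] /imsetP[u + ->]]; last 2 first.
- by rewrite inE.
- by rewrite inE.
case/tupleP: t => -[] u pu; [left|right]; apply/imsetP; exists u => //; by rewrite inE.
Qed.

Lemma count_idD (m : nat) (t : m.-tuple bool) : count id t + count negb t = m.
Proof. by rewrite -[RHS](size_tuple t) -(count_predC id t). Qed.

(** Prescribing a lower bound on the number of up-steps, rather than the number itself, turns
    differences of binomials into single ones. *)
Definition upaths m a :=
  #|[set t : m.-tuple bool | positive_path t && (a <= count negb t)]|.

(** Under the hypothesis, [a + 1] up-steps already outnumber the down-steps, so positivity of the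
    whole word reduces to that of the word without its first letter. *)
Lemma upathsS m a : m.+1 < a.+1.*2 ->
  upaths m.+1 a.+1 = upaths m a.+1 + upaths m a.
Proof.
move=> lm; rewrite /upaths.
rewrite (card_tupleS m (fun s => positive_path s && (a.+1 <= count negb s))).
congr (_ + _); congr #|pred_of_set _|; apply/setP => t; rewrite !inE /=;
  have := count_idD t; case: (positive_path t); lia.
Qed.

(** Exactly [b + 1] up-steps would bring the path back to height 0. *)
Lemma upaths_diag b : upaths b.+1.*2 b.+1 = upaths b.+1.*2 b.+2.
Proof.
congr #|pred_of_set _|; apply/setP => t; rewrite !inE.
have := count_idD t; case: t => -[|x s] //= st.
by case: (positive_path s); lia.
Qed.

Lemma upaths_binomial m a : m.+1 < a.+1.*2 -> upaths m.+1 a.+1 = 'C(m, a).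
Proof.
elim: m a => [|m IH] a lm.
  rewrite upathsS // bin0n /upaths.
  have c0 c : #|[set t : 0.-tuple bool | positive_path t && (c <= count negb t)]| = (c == 0).
    case: c => [|c].
      have -> : [set t : 0.-tuple bool | positive_path t && (0 <= count negb t)] = setT.
        by apply/setP => t; rewrite !inE tuple0.
      by rewrite cardsT card_tuple.
    by apply/eqP; rewrite cards_eq0; apply/eqP/setP => t; rewrite !inE tuple0.
  by rewrite !c0 add0n.
rewrite upathsS // IH; last by lia.
case: a lm => [|b] lm; first by lia.
rewrite binS; congr (_ + _); case: (ltnP m.+1 b.+1.*2) => lm'; first exact: IH.
(* The boundary case of Pascal's rule: [upaths_diag] raises the bound by one, and the symmetry of
   the binomials of odd order [m] compensates. *)
have em : m = b.*2.+1 by lia.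
have -> : m.+1 = b.+1.*2 by lia.
rewrite upaths_diag; have -> : b.+1.*2 = m.+1 by lia.
rewrite IH; last by lia.
by rewrite -bin_sub; [congr 'C(_, _)|]; lia.
Qed.

Lemma card_positive_path k : 0 < k ->
  #|[set t : (2 * k).-tuple bool | positive_path t]| = 'C(2 * k - 1, k).
Proof.
move=> k0; have e : 2 * k = (2 * k - 1).+1 by lia.
rewrite -[RHS]upaths_binomial; last by lia.
rewrite -e; congr #|pred_of_set _|; apply/setP => t; rewrite !inE.
(* Ending above 0 after [2 * k] steps means at least [k + 1] up-steps; [k > 0] rules out the empty
   word, which is vacuously positive. *)
have := count_idD t; case: t => -[|x s] st /=; first by move: st => /=; lia.
by case: (positive_path s); lia.
Qed.

(* A positive path of even length ends at height at least 2, hence both of its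
   one-step extensions are positive; the parity condition selects one. *)
Lemma card_positive_path_parity k : 0 < k ->
  #|[set t : (2 * k + 1).-tuple bool | positive_path t && ~~ odd (k + count id t)]|
    = 'C(2 * k - 1, k).
Proof.
move=> k0; rewrite -card_positive_path // addn1.
rewrite (card_tupleS _ (fun s => positive_path s && ~~ odd (k + count id s))).
pose E := [set t : (2 * k).-tuple bool | odd (k + count id t)].
rewrite -(cardsID E [set t : (2 * k).-tuple bool | positive_path t]).
have pos (t : (2 * k).-tuple bool) : positive_path t -> count id t < count negb t.
  case: t => -[|x s] //= st; first by move: st => /=; lia.
  by case/andP.
congr (_ + _); congr #|pred_of_set _|; apply/setP => t; rewrite !inE /=;
  have := count_idD t; have := pos t; case: (positive_path t) => //=; lia.
Qed.

(** * Encoding by positive paths *)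

Lemma initial_segment_exists n (A : {set 'I_n}) r : r <= #|A| ->
  exists P : {set 'I_n}, [/\ P \subset A, #|P| = r
    & forall p v, p \in P -> v \in A :\: P -> p < v].
Proof.
elim: r => [|r IH] rA.
  by exists set0; split; rewrite ?sub0set ?cards0 // => p v; rewrite inE.
have [|P [PA cP Plt]] := IH; first exact: ltnW.
have [v0 v0A] : exists v, v \in A :\: P.
  by apply/set0Pn; rewrite -card_gt0 cardsD (setIidPr PA) cP subn_gt0.
case: (@arg_minnP _ v0 (mem (A :\: P)) (@nat_of_ord _) v0A) => m.
rewrite -[mem _ m]/(m \in A :\: P) => mA mmin.
move: (mA); rewrite inE => /andP[mP mA'].
exists (m |: P); split; first by rewrite subUset sub1set mA'.
  by rewrite cardsU1 mP cP.
move=> p v; rewrite !inE negb_or => pP /andP[/andP[vm vP] vA].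
have vAP : v \in A :\: P by rewrite inE vP.
case/orP: pP => [/eqP ->|pP]; last exact: Plt.
by rewrite ltn_neqAle eq_sym vm; apply: mmin.
Qed.

(** If neither set contained the other, an element of [P1] outside [P2] and one of [P2] outside [P1]
    would each be smaller than the other. *)
Lemma initial_segment_unique n (A P1 P2 : {set 'I_n}) :
  P1 \subset A -> P2 \subset A -> #|P1| = #|P2| ->
  (forall p v, p \in P1 -> v \in A :\: P1 -> p < v) ->
  (forall p v, p \in P2 -> v \in A :\: P2 -> p < v) -> P1 = P2.
Proof.
move=> P1A P2A c12 lt1 lt2; apply/eqP; rewrite eqEcard c12 leqnn andbT.
apply/negPn/negP => /subsetPn[x x1 x2].
have : P2 \subset P1.
  apply/subsetP => y y2; apply/negPn/negP => y1.
  have := lt1 x y x1; have := lt2 y x y2; rewrite !inE x2 y1.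
  by rewrite (subsetP P1A) // (subsetP P2A) // => /(_ isT) ? /(_ isT); lia.
by move=> s; move: x2; rewrite (eqP (_ : P2 == P1)) ?x1 // eqEcard s c12 leqnn.
Qed.

Definition neg_part n (S : {set pm n}) : {set 'I_n} := [set i | (true, i) \in S].
Definition pos_part n (S : {set pm n}) : {set 'I_n} := [set i | (false, i) \in S].

Definition signed_set n (Q P : {set 'I_n}) : {set pm n} :=
  [set x : pm n | if x.1 then x.2 \in Q else x.2 \in P].

(** Positivity of the path that reads absolute values downwards from the largest, stepping down on
    [Q] and up elsewhere. *)
Definition ballot n (Q : {set 'I_n}) : bool :=
  [forall i : 'I_n, #|[set q in Q | i <= q]| < #|[set a in ~: Q | i <= a]|].

Lemma signed_setK n (S : {set pm n}) : signed_set (neg_part S) (pos_part S) = S.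
Proof. by apply/setP => -[[] i]; rewrite !inE. Qed.

Lemma neg_part_signed n (Q P : {set 'I_n}) : neg_part (signed_set Q P) = Q.
Proof. by apply/setP => i; rewrite !inE. Qed.

Lemma signed_set_inj_snd n (Q P : {set 'I_n}) :
  {in signed_set Q P &, injective snd} <-> [disjoint Q & P].
Proof.
split=> [iS|dQP].
  rewrite -setI_eq0; apply/eqP/setP => i; rewrite !inE; apply/negP => /andP[iQ iP].
  by have := iS (true, i) (false, i); rewrite !inE /= iQ iP => /(_ isT isT erefl).
have nQP i : i \in Q -> i \in P -> False by move=> iQ; rewrite (disjointFr dQP iQ).
by case=> [[] a] [[] b]; rewrite !inE /= => ha hb e; rewrite e // in ha *; case: (nQP b).
Qed.

Lemma abs_signed_set n (Q P : {set 'I_n}) : abs_set (signed_set Q P) = Q :|: P.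
Proof.
apply/setP => i; rewrite inE; apply/imsetP/orP => [[[[] j]]|[iQ|iP]].
- by rewrite inE /= => ? ->; left.
- by rewrite inE /= => ? ->; right.
- by exists (true, i); rewrite // inE.
- by exists (false, i); rewrite // inE.
Qed.

Lemma card_signed_set n (Q P : {set 'I_n}) : #|signed_set Q P| = #|Q| + #|P|.
Proof.
rewrite -(cardsID [set x : pm n | x.1] (signed_set Q P)).
have inj (b : bool) : injective (fun i : 'I_n => (b, i)) by move=> i j [].
rewrite -(card_imset Q (inj true)) -(card_imset P (inj false)).
congr (_ + _); congr #|pred_of_set _|; apply/setP => -[b i]; rewrite !inE /=.
  apply/andP/imsetP => [[+ h]|[j jQ [-> ->]]] //; rewrite h => iQ.
  by exists i; rewrite // h.
apply/andP/imsetP => [[+]|[j jQ [-> ->]]] //; case: b => //= _ iP.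
by exists i.
Qed.

Lemma card_negs_neg_fill n (Q P : {set 'I_n}) :
  #|negs (neg_fill (signed_set Q P))| = #|Q :|: ~: (Q :|: P)|.
Proof.
have inj : injective (fun i : 'I_n => (true, i)) by move=> i j [].
rewrite -(card_imset _ inj); congr #|pred_of_set _|; apply/setP => -[b i].
rewrite in_set in_setU in_set in_set abs_signed_set /=.
apply/andP/imsetP => [[+ h]|[j jQ [-> ->]]]; last by rewrite !inE in jQ *.
by rewrite h => iQ; exists i; rewrite // !inE in iQ *.
Qed.

(** Only negative values lie below a negative one, and negation reverses the order of absolute
    values. *)
Lemma card_below_neg n (Q P : {set 'I_n}) (q : 'I_n) :
  #|[set x in signed_set Q P | ~~ pm_lt (true, q) x]| = #|[set i in Q | q <= i]|.
Proof.
have inj : injective (fun i : 'I_n => (true, i)) by move=> i j [].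
rewrite -(card_imset _ inj); congr #|pred_of_set _|; apply/setP => -[b i].
rewrite !inE; apply/andP/imsetP => [[]|[j + [-> ->]]].
  case: b => /= iQ lt; last by move: lt; rewrite /pm_lt /pm_val /=; lia.
  by exists i; rewrite // inE iQ; move: lt; rewrite /pm_lt /pm_val /=; lia.
by rewrite inE /= => /andP[-> le]; split=> //; move: le; rewrite /pm_lt /pm_val /=; lia.
Qed.

Lemma card_fill_below_neg n (S : {set pm n}) (q : 'I_n) :
  #|[set v in neg_fill S :\: S | pm_lt v (true, q)]| = #|[set i in ~: abs_set S | q < i]|.
Proof.
have inj : injective (fun i : 'I_n => (true, i)) by move=> i j [].
rewrite -(card_imset _ inj); congr #|pred_of_set _|; apply/setP => -[b i].
rewrite inE mem_neg_fillD /=; apply/andP/imsetP => [[/andP[h iS] lt]|[j + [-> ->]]].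
  exists i; rewrite ?h // !inE iS; move: lt; rewrite h /pm_lt /pm_val /=; lia.
by rewrite !inE => /andP[-> le]; split=> //; move: le; rewrite /pm_lt /pm_val /=; lia.
Qed.

(** Domination tests only elements of [S] and counts only [V], whereas [ballot] tests every [i] and
    counts all of [~: Q]; [alt] reconciles the two counts. *)
Lemma dominated_ballot k (Q P : {set 'I_(2 * k + 1)}) :
  [disjoint Q & P] -> #|Q| + #|P| = k ->
  (forall p v, p \in P -> v \in ~: (Q :|: P) -> p < v) ->
  dominated (signed_set Q P) (neg_fill (signed_set Q P)) <-> ballot Q.
Proof.
move=> dQP cQP Plt; pose V := ~: (Q :|: P).
have cV : #|V| = k.+1.
  have := cardsC (Q :|: P); rewrite -/V card_ord cardsU (disjoint_setI0 dQP) cards0.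
  lia.
have VnQ : V \subset ~: Q by rewrite setCS subsetUl.
have leQ i : #|[set q in Q | i <= q]| <= k.
  apply: (@leq_trans #|Q|); last by lia.
  by apply/subset_leq_card/subsetP => x; rewrite inE => /andP[].
have leVA (i : 'I_(2 * k + 1)) : #|[set a in V | i <= a]| <= #|[set a in ~: Q | i <= a]|.
  apply/subset_leq_card/subsetP => x; rewrite inE => /andP[xV xi].
  by rewrite inE (subsetP VnQ).
(* Either all of [V] is above [i], and [V] alone outnumbers [Q]; or some element
   of [V], hence all of [P], lies below [i]. *)
have alt (i : 'I_(2 * k + 1)) : #|[set a in V | i <= a]| = k.+1 \/
    [set a in ~: Q | i <= a] = [set a in V | i <= a].
  case: (boolP [exists v in V, v < i]) => [/existsP[v /andP[vV vi]]|/existsPn h].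
    right; apply/setP => a; rewrite !inE negb_or.
    case: (boolP (a \in Q)) => //= aQ; case: (boolP (a \in P)) => //= aP.
    by have := Plt a v aP vV; lia.
  left; rewrite -cV; congr #|pred_of_set _|; apply/setP => a; rewrite inE.
  case: (boolP (a \in V)) => //= aV; have := h a; rewrite aV /=; lia.
split=> [dom|/forallP bal].
  apply/forallP => i; apply: leq_trans (leVA i).
  case: (alt i) => [->|eV]; first by rewrite ltnS leQ.
  (* Domination is applied at the least [m >= i] in [Q]: passing from [i] to [m] keeps the count in
     [Q] and cannot increase the one in [V]. If there is no such [m], then [i] itself lies outside
     [Q]. *)
  case: (pickP (mem [set q in Q | i <= q])) => [q0 q0Q|noq].
    case: (@arg_minnP _ q0 (mem [set q in Q | i <= q]) (@nat_of_ord _) q0Q) => m.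
    rewrite -[mem _ m]/(m \in [set q in Q | i <= q]) inE => /andP[mQ im] mmin.
    have := dom (true, m); rewrite inE => /(_ mQ).
    rewrite card_below_neg card_fill_below_neg abs_signed_set -/V => lt.
    apply: leq_ltn_trans (leq_trans lt _); apply/subset_leq_card/subsetP => x.
      by move=> xQ; move: (mmin x xQ); move: xQ; rewrite !inE => /andP[-> _].
    by rewrite !inE => /andP[-> lx]; lia.
  rewrite (_ : [set q in Q | i <= q] = set0) ?cards0; last first.
    by apply/setP => x; rewrite [RHS]inE; apply: noq.
  rewrite card_gt0; apply/set0Pn; exists i; rewrite -eV !inE leqnn andbT.
  by have := noq i; rewrite /= inE leqnn andbT => ->.
move=> [[] q]; rewrite inE /= => qS.
  rewrite card_below_neg card_fill_below_neg abs_signed_set -/V.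
  have -> : [set i in V | q < i] = [set i in V | q <= i].
    apply/setP => a; rewrite !inE [in RHS]leq_eqVlt.
    by case: eqP => [/ord_inj <-|//]; rewrite qS.
  have := bal q; case: (alt q) => [->|-> //]; by rewrite ltnS leQ.
(* Domination at a positive element is automatic: all [k + 1] non-pinnacles are negative, and [S]
   has only [k] elements. *)
apply: (@leq_ltn_trans #|signed_set Q P|).
  by apply/subset_leq_card/subsetP => x; rewrite inE => /andP[].
rewrite card_signed_set cQP; apply: (@leq_trans #|V|); first by rewrite cV.
have inj : injective (fun i : 'I_(2 * k + 1) => (true, i)) by move=> i j [].
rewrite -(card_imset V inj); apply/subset_leq_card/subsetP => _ /imsetP[v vV ->].
rewrite inE mem_neg_fillD abs_signed_set /=; move: vV; rewrite in_setC => ->.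
by rewrite /pm_lt /pm_val /=; lia.
Qed.

Lemma APSBD_signed_setP k (Q P : {set 'I_(2 * k + 1)}) : 0 < k ->
  signed_set Q P \in APSB (2 * k + 1) :\: APSD (2 * k + 1) <->
  [/\ [disjoint Q & P], #|Q| + #|P| = k,
      forall p v, p \in P -> v \in ~: (Q :|: P) -> p < v,
      ballot Q & ~~ odd (k + #|Q|)].
Proof.
move=> k0; rewrite in_setD.
(* Exactly the values from [P] are positive, which leaves [2k + 1 - (k - #|Q|) = k + 1 + #|Q|]
   negative ones. *)
have oddE : [disjoint Q & P] -> #|Q| + #|P| = k ->
    odd #|negs (neg_fill (signed_set Q P))| = ~~ odd (k + #|Q|).
  move=> dQP cQP; rewrite card_negs_neg_fill cardsU.
  have -> : Q :&: ~: (Q :|: P) = set0.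
    by apply/setP => i; rewrite !inE; case: (i \in Q).
  have := cardsC (Q :|: P); rewrite card_ord cardsU (disjoint_setI0 dQP) cards0.
  by move: cQP; clear; lia.
split=> [/andP[SnD SB]|[dQP cQP Plt bal par]].
  have [iS dS] := APSBP _ SB; have dQP := (signed_set_inj_snd Q P).1 iS.
  have [cS lt od] := APSBD_necessary SB SnD.
  rewrite card_signed_set in cS.
  have Plt p v : p \in P -> v \in ~: (Q :|: P) -> p < v.
    rewrite in_setC -abs_signed_set => pP vS.
    have := lt (false, p) v; rewrite inE => /(_ pP vS).
    by rewrite /pm_lt /pm_val /=; clear; lia.
  split=> //; last by rewrite -oddE.
  exact/(dominated_ballot dQP cS Plt).
apply/andP; split.
  apply: APSBD_sufficient => //; rewrite ?card_signed_set ?oddE // => -[[] p] v;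
    rewrite inE abs_signed_set -in_setC //= => pP vS.
  by have := Plt p v pP vS; rewrite /pm_lt /pm_val /=; clear; lia.
apply/APSBP; split; first exact/signed_set_inj_snd.
exact/(dominated_ballot dQP cQP Plt).
Qed.

Lemma card_APSBD k : 0 < k ->
  #|APSB (2 * k + 1) :\: APSD (2 * k + 1)| =
  #|[set Q : {set 'I_(2 * k + 1)} | ballot Q && ~~ odd (k + #|Q|)]|.
Proof.
move=> k0.
have seg (Q P : {set 'I_(2 * k + 1)}) : ~: Q :\: P = ~: (Q :|: P).
  by apply/setP => i; rewrite !inE negb_or andbC.
have ninj : {in APSB (2 * k + 1) :\: APSD (2 * k + 1) &, injective (@neg_part (2 * k + 1))}.
  move=> S T; rewrite -{1}(signed_setK S) -{1}(signed_setK T).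
  move=> /APSBD_signed_setP [] // dS cS Slt _ _ /APSBD_signed_setP [] // dT cT Tlt _ _ eN.
  rewrite -(signed_setK S) -(signed_setK T) -eN; congr signed_set.
  apply: (@initial_segment_unique _ (~: neg_part S)).
  - by rewrite -disjoints_subset disjoint_sym.
  - by rewrite eN -disjoints_subset disjoint_sym.
  - by move: cS cT; rewrite -eN; clear; lia.
  - by move=> p v pP; rewrite seg; apply: Slt.
  - by move=> p v pP; rewrite eN seg; apply: Tlt.
rewrite -(card_in_imset ninj); congr #|pred_of_set _|; apply/setP => Q; rewrite inE.
apply/imsetP/andP => [[S SBD ->]|[bal par]].
  by move: SBD; rewrite -{1}(signed_setK S) => /APSBD_signed_setP [].
have n0 : 0 < 2 * k + 1 by rewrite addn1.
have cC := cardsC Q; rewrite card_ord in cC.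
(* The ballot condition at the smallest index compares [Q] with its whole complement, so there is
   room for the [k - #|Q|] elements of [P]. *)
have cQ : #|Q| <= k.
  have e (A : {set 'I_(2 * k + 1)}) : [set x in A | Ordinal n0 <= x] = A.
    by apply/setP => x; rewrite inE andbT.
  by have := forallP bal (Ordinal n0); rewrite !e; move: cC; clear; lia.
have [|P [PQ cP Plt]] := @initial_segment_exists _ (~: Q) (k - #|Q|).
  by move: cC cQ; clear; lia.
exists (signed_set Q P); last by rewrite neg_part_signed.
apply/(APSBD_signed_setP _ _ k0); split=> //.
- by rewrite disjoint_sym disjoints_subset.
- by rewrite cP subnKC.
- by move=> p v pP; rewrite -seg; apply: Plt.
Qed.

Lemma card_set_drop n (t : n.-tuple bool) (f : pred bool) (i : nat) : i <= n ->
  #|[set j : 'I_n | f (tnth t j) && (i <= j)]| = count f (drop i t).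
Proof.
move=> li; pose p j := f (nth false t j) && (i <= j).
transitivity (count p (iota 0 n)).
  have -> : iota 0 n = index_iota 0 n by rewrite /index_iota subn0.
  rewrite -sum1_count big_mkord sum1dep_card.
  by congr #|pred_of_set _|; apply/setP => j; rewrite !inE (tnth_nth false).
have -> : drop i t = [seq nth false t j | j <- iota i (n - i)].
  rewrite -{1}(mkseq_nth false t) size_tuple /mkseq -map_drop.
  by rewrite drop_iota add0n.
have -> : iota 0 n = iota 0 i ++ iota i (n - i) by rewrite -iotaD subnKC.
rewrite count_map count_cat.
rewrite (eq_in_count (a2 := pred0)) ?count_pred0 ?add0n; last first.
  by move=> j; rewrite mem_iota /p /=; case: (f _) => //=; clear; lia.
by apply: eq_in_count => j; rewrite mem_iota /p /= => /andP[-> _]; rewrite andbT.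
Qed.

Lemma card_ballot_parity k : 0 < k ->
  #|[set Q : {set 'I_(2 * k + 1)} | ballot Q && ~~ odd (k + #|Q|)]| =
  #|[set t : (2 * k + 1).-tuple bool | positive_path t && ~~ odd (k + count id t)]|.
Proof.
move=> k0; pose n := 2 * k + 1.
(* Sets correspond to their characteristic words. Paths are read from the last letter, so the suffix
   from [i] on records the elements at least [i], as in [ballot]. *)
pose h (t : n.-tuple bool) : {set 'I_n} := [set i | tnth t i].
have hinj : injective h.
  by move=> t u /setP e; apply: eq_from_tnth => i; have := e i; rewrite !inE.
rewrite -(card_imset _ hinj); congr #|pred_of_set _|; apply/setP => Q; rewrite inE.
have hQ : Q = h [tuple i \in Q | i < n].
  by apply/setP => i; rewrite inE tnth_mktuple.
rewrite {3}hQ mem_imset // inE {1 2}hQ; set t := [tuple i \in Q | i < n].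
congr (_ && ~~ odd (_ + _)); last first.
  have := @card_set_drop n t id 0 (leq0n _); rewrite drop0 => <-.
  by congr #|pred_of_set _|; apply/setP => i; rewrite !inE andbT.
have E (i : 'I_n) : (#|[set q in h t | i <= q]| < #|[set a in ~: h t | i <= a]|) =
    (count id (drop i t) < count negb (drop i t)).
  rewrite -!(@card_set_drop n t _ i (ltnW (ltn_ord i))).
  by congr (_ < _); congr #|pred_of_set _|; apply/setP => j; rewrite !inE.
apply/forallP/positive_path_drop => [bal i|bal i]; last by rewrite E bal ?size_tuple.
by rewrite size_tuple => li; have := bal (Ordinal li); rewrite E.
Qed.

Theorem theorem4p9 (k : nat) (hk : 1 <= k) :
  #|APSB (2 * k + 1) :\: APSD (2 * k + 1)| = 'C(2 * k - 1, k).
Proof. by rewrite card_APSBD // card_ballot_parity // card_positive_path_parity. Qed.
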